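(* For every sequence $\bar p=(p_j)_{j\ge1}$ with $p_j\in(0,1]$ and every sequence of integers $\bar d=(d_j)_{j\ge0}$ with $d_0=1$ and $d_j\ge2$ for $j\ge1$, $$E_{\bar d,\bar p}=\sigma(l^\infty,\bar d,\bar p)=\sigma_p(l^\infty,\bar d,\bar p).$$
   Context: $\mathbb{Z}_+=\{0,1,2,\dots\}$. Put $q_j=d_0d_1\cdots d_j$ for $j\ge 0$. Every $n\in\mathbb{Z}_+$ has a unique expansion $n=\sum_{j\ge1}a_j(n)q_{j-1}$ with digits $a_j(n)\in\{0,\dots,d_j-1\}$, only finitely many nonzero. Put $\zeta_n=\min\{j\ge1: a_j(n)\ne d_j-1\}$. Let $S=[s(n,m)]_{n,m\ge0}$ be the stochastic matrix with entries: $s(n,n+1)=\prod_{j=1}^{\zeta_n}p_j$; $s(n,n)=1-p_1$; if $\zeta_n\ge2$, for $1\le r\le\zeta_n-1$, $s\big(n,\,n-\sum_{j=1}^r(d_j-1)q_{j-1}\big)=(1-p_{r+1})\prod_{j=1}^rp_j$; and $s(n,m)=0$ otherwise. $S$ acts as a bounded linear operator on $l^\infty=l^\infty(\mathbb{Z}_+)$ (complex bounded sequences, sup norm) by $(Sw)(n)=\sum_m s(n,m)w(m)$. $\sigma(l^\infty,\bar d,\bar p)$ and $\sigma_p(l^\infty,\bar d,\bar p)$ denote the spectrum and the point spectrum (set of eigenvalues) of $S$ on $l^\infty$. For $j\ge1$ let $f_j(z)=\left(\frac{z-(1-p_j)}{p_j}\right)^{d_j}$, $z\in\mathbb{C}$,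 and $\tilde f_j=f_j\circ\cdots\circ f_1$. Put $E_{\bar d,\bar p}=\{z\in\mathbb{C}:\limsup_{j\to\infty}|\tilde f_j(z)|<+\infty\}$. *)

(* Defs.v *)
From HB Require Import structures.
From mathcomp Require Import all_boot all_order all_algebra.
From mathcomp Require Import all_classical all_reals all_analysis.
From mathcomp Require Import complex.
From mathcomp Require Import zify ring lra.

Set Implicit Arguments.
Unset Strict Implicit.
Unset Printing Implicit Defensive.

Import Order.TTheory GRing.Theory Num.Theory numFieldNormedType.Exports.

Local Open Scope classical_set_scope.
Local Open Scope ring_scope.

(* Sequences are functions on nat; [p 0] is never used. *)

Definition q (d : nat -> nat) (j : nat) : nat := (\prod_(0 <= i < j.+1) d i)%N.

(* [digit d j n] is a_j(n), for j >= 1; the lemmas [digit_expansion] and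
   [digit_unique] below show that it is the digit of the unique expansion. *)
Definition digit (d : nat -> nat) (j n : nat) : nat :=
  ((n %/ q d j.-1) %% d j)%N.

(* The junk value 0 never occurs when d_j >= 2 for all j >= 1 ([zeta_ex]). *)
Definition zeta (d : nat -> nat) (n : nat) : nat :=
  match pselect (exists j, (1 <= j)%N && (digit d j n != (d j).-1)) with
  | left ex_j => ex_minn ex_j
  | right _ => 0%N
  end.

(* n - sum_(j = 1)^r (d_j - 1) q_(j-1); the subtraction is exact for
   1 <= r <= zeta_n - 1 ([drop_le]). *)
Definition drop_target (d : nat -> nat) (n r : nat) : nat :=
  (n - \sum_(1 <= j < r.+1) (d j).-1 * q d j.-1)%N.

Section operator.
Variable R : realType.
Implicit Types (d : nat -> nat) (p : nat -> R) (n m : nat).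

(* The last sum has at most one term, since the targets are distinct
   ([drop_target_inj]); the entries are listed in [s_up], [s_diag], [s_drop]
   and [s_zero]. *)
Definition s d p n m : R :=
  if m == n.+1 then \prod_(1 <= j < (zeta d n).+1) p j
  else if m == n then 1 - p 1%N
  else \sum_(1 <= r < zeta d n | m == drop_target d n r)
         (1 - p r.+1) * \prod_(1 <= j < r.+1) p j.

Definition Sop d p (w : nat -> R[i]) : nat -> R[i] := fun n =>
  limn (series (fun m => (s d p n m)%:C%C * w m : R[i]^o)).

Definition linf : set (nat -> R[i]) :=
  [set w | exists M : R, forall n, Normc.normc (w n) <= M].

Definition linf_norm (w : nat -> R[i]) : R :=
  sup (range (fun n => Normc.normc (w n))).

(* Operators on l^oo are represented by maps on all complex sequences, of which
   only the restriction to [linf] matters. *)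
Record bounded_operator (A : (nat -> R[i]) -> nat -> R[i]) : Prop := {
  bop_linf : forall w, linf w -> linf (A w);
  bop_linear : forall (c : R[i]) u v, linf u -> linf v ->
    A (fun n => c * u n + v n) = (fun n => c * A u n + A v n);
  bop_bounded : exists K : R, forall w, linf w ->
    linf_norm (A w) <= K * linf_norm w }.

Definition sub_scalar (A : (nat -> R[i]) -> nat -> R[i]) (z : R[i]) :
    (nat -> R[i]) -> nat -> R[i] :=
  fun w n => A w n - z * w n.

Definition invertible_linf (A : (nat -> R[i]) -> nat -> R[i]) : Prop :=
  exists B, bounded_operator B /\
    forall w, linf w -> B (A w) = w /\ A (B w) = w.

Definition spectrum (A : (nat -> R[i]) -> nat -> R[i]) : set R[i] :=
  [set z | ~ invertible_linf (sub_scalar A z)].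

Definition point_spectrum (A : (nat -> R[i]) -> nat -> R[i]) : set R[i] :=
  [set z | exists w, [/\ linf w, w <> (fun=> 0) & A w = (fun n => z * w n)]].

Definition fj d p (j : nat) (z : R[i]) : R[i] :=
  ((z - (1 - p j)%:C%C) / (p j)%:C%C) ^+ d j.

(* f_j o ... o f_1, with the empty composition at j = 0. *)
Fixpoint ftilde d p (j : nat) (z : R[i]) : R[i] :=
  if j is j'.+1 then fj d p j (ftilde d p j' z) else z.

Definition Eset d p : set R[i] :=
  [set z | (limn_esup (fun j => (Normc.normc (ftilde d p j z))%:E) < +oo)%E].

End operator.

Section digits.
Variable d : nat -> nat.
Hypothesis d0 : d 0%N = 1%N.
Hypothesis d_ge2 : forall j, (1 <= j)%N -> (2 <= d j)%N.

Lemma d_gt0 j : (0 < d j)%N.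
Proof. by case: j => [|j]; rewrite ?d0// (leq_trans _ (d_ge2 _)). Qed.

Lemma q0 : q d 0 = 1%N.
Proof. by rewrite /q big_nat1. Qed.

Lemma qS j : q d j.+1 = (q d j * d j.+1)%N.
Proof. by rewrite /q big_nat_recr. Qed.

Lemma q_gt0 j : (0 < q d j)%N.
Proof. by elim: j => [|j IH]; rewrite ?q0// qS muln_gt0 IH d_gt0. Qed.

Lemma q_gt j : (j < q d j)%N.
Proof.
elim: j => [|j IH]; first by rewrite q0.
rewrite qS; have := @d_ge2 j.+1 isT; nia.
Qed.

Lemma digit_lt j n : (digit d j n < d j)%N.
Proof. by rewrite /digit ltn_mod d_gt0. Qed.

Lemma digit_eq0 j n : (n < j)%N -> digit d j n = 0%N.
Proof.
case: j => // j nj; rewrite /digit /= divn_small ?mod0n//.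
by move: nj; rewrite ltnS => /leq_ltn_trans; apply; exact: q_gt.
Qed.

Lemma digit_sum_mod n k :
  (\sum_(1 <= j < k.+1) digit d j n * q d j.-1)%N = (n %% q d k)%N.
Proof.
elim: k => [|k IH]; first by rewrite big_geq// q0 modn1.
rewrite big_nat_recr//= IH qS /digit /=.
set x := (n %/ q d k)%N.
have := divn_eq n (q d k); rewrite -/x => En.
have := divn_eq x (d k.+1) => Ex.
have Enx : n = (x %/ d k.+1 * (q d k * d k.+1) +
               (n %% q d k + x %% d k.+1 * q d k))%N.
  by rewrite {1}En {1}Ex; ring.
rewrite [in RHS]Enx modnMDl [RHS]modn_small//.
have := ltn_pmod n (q_gt0 k); have := ltn_pmod x (d_gt0 k.+1).
by move: (n %% _)%N (x %% _)%N => a b; nia.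
Qed.

Lemma digit_expansion n :
  n = (\sum_(1 <= j < n.+1) digit d j n * q d j.-1)%N.
Proof. by rewrite digit_sum_mod modn_small// q_gt. Qed.

Lemma expansion_lt (b : nat -> nat) k :
  (forall j, (1 <= j)%N -> (b j < d j)%N) ->
  (\sum_(1 <= j < k.+1) b j * q d j.-1 < q d k)%N.
Proof.
move=> bd; elim: k => [|k IH]; first by rewrite big_geq// q0.
by rewrite big_nat_recr//= qS; have := bd k.+1 isT; nia.
Qed.

Lemma digit_unique (b : nat -> nat) N n :
  (forall j, (1 <= j)%N -> (b j < d j)%N) ->
  n = (\sum_(1 <= j < N.+1) b j * q d j.-1)%N ->
  forall j, (1 <= j <= N)%N -> b j = digit d j n.
Proof.
move=> bd; elim: N n => [|N IH] n; first by move=> _ [].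
rewrite big_nat_recr//=.
set t := (\sum_(_ <= _ < _) _)%N => En j /andP[j1].
have tq : (t < q d N)%N by exact: expansion_lt.
rewrite leq_eqVlt => /predU1P[->|]; last first.
  rewrite ltnS => jN; rewrite (IH t)//; last by rewrite j1.
  have [k Ek] : exists k, q d N = (q d j * k)%N.
    elim: N jN {IH En tq t} => [|N IH]; first by case: j j1.
    rewrite leq_eqVlt => /predU1P[->|]; first by exists 1%N; rewrite muln1.
    by rewrite ltnS => /IH[k Ek]; exists (k * d N.+1)%N; rewrite qS Ek mulnA.
  case: j j1 jN Ek => // j _ jN; rewrite qS => Ek.
  rewrite /digit /= En Ek.
  have -> : (b N.+1 * (q d j * d j.+1 * k) =
             (b N.+1 * k * d j.+1) * q d j)%N by ring.
  by rewrite addnC divnMDl ?q_gt0// modnMDl.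
by rewrite /digit /= En addnC divnMDl ?q_gt0// divn_small// addn0 modn_small// bd.
Qed.

Lemma zeta_ex n : exists j, (1 <= j)%N && (digit d j n != (d j).-1).
Proof. by exists n.+1; rewrite /= digit_eq0//; have := @d_ge2 n.+1 isT; lia. Qed.

Lemma zetaP n : [/\ (1 <= zeta d n)%N, digit d (zeta d n) n != (d (zeta d n)).-1
  & forall j, (1 <= j < zeta d n)%N -> digit d j n = (d j).-1].
Proof.
rewrite /zeta; case: pselect => [h|[]]; last exact: zeta_ex.
case: ex_minnP => m /andP[m1 dm] min; split=> // j /andP[j1 jm].
apply/eqP/negPn/negP => dj.
by have := min j; rewrite j1 dj => /(_ isT); rewrite leqNgt jm.
Qed.

Lemma drop_le n r : (r < zeta d n)%N ->
  (\sum_(1 <= j < r.+1) (d j).-1 * q d j.-1 <= n)%N.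
Proof.
move=> rz; have [_ _ dz] := zetaP n.
rewrite (eq_big_nat _ _ (F2 := fun j => (digit d j n * q d j.-1)%N)).
  by rewrite digit_sum_mod leq_mod.
by move=> j /andP[j1 jr]; rewrite dz// j1 (leq_trans jr).
Qed.

Lemma drop_sum_mono r r' : (r < r')%N ->
  (\sum_(1 <= j < r.+1) (d j).-1 * q d j.-1 <
   \sum_(1 <= j < r'.+1) (d j).-1 * q d j.-1)%N.
Proof.
elim: r' => // r' IH rr'; rewrite [X in (_ < X)%N]big_nat_recr//=.
have c0 : (0 < (d r'.+1).-1 * q d r')%N.
  by rewrite muln_gt0 q_gt0 andbT; have := @d_ge2 r'.+1 isT; lia.
have [->|ne] := eqVneq r r'; first by lia.
have {}/IH : (r < r')%N by lia.
lia.
Qed.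

Lemma drop_target_lt n r : (1 <= r < zeta d n)%N -> (drop_target d n r < n)%N.
Proof.
move=> /andP[r1 rz]; have := drop_le rz; have := drop_sum_mono r1.
by rewrite /drop_target; lia.
Qed.

Lemma drop_target_inj n r r' : (r < zeta d n)%N -> (r' < zeta d n)%N ->
  drop_target d n r = drop_target d n r' -> r = r'.
Proof.
move=> /drop_le + /drop_le; rewrite /drop_target => h h'.
by case: (ltngtP r r') => // /drop_sum_mono; lia.
Qed.

Section matrix.
Variables (R : realType) (p : nat -> R).

Lemma s_up n : s d p n n.+1 = \prod_(1 <= j < (zeta d n).+1) p j.
Proof. by rewrite /s eqxx. Qed.

Lemma s_diag n : s d p n n = 1 - p 1%N.
Proof. by rewrite /s ltn_eqF// eqxx. Qed.

Lemma s_drop n r : (1 <= r <= (zeta d n).-1)%N ->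
  s d p n (n - \sum_(1 <= j < r.+1) (d j).-1 * q d j.-1)%N =
  (1 - p r.+1) * \prod_(1 <= j < r.+1) p j.
Proof.
move=> rz; rewrite -/(drop_target d n r).
have {}rz : (1 <= r < zeta d n)%N by have [] := zetaP n; lia.
have tn := drop_target_lt rz; have /andP[r1 rz'] := rz.
rewrite /s !ltn_eqF ?(leq_trans tn)// big_mkcond.
rewrite (bigD1_seq r) ?iota_uniq ?mem_index_iota//= eqxx [X in _ + X]big1_seq ?addr0//.
move=> i /andP[ir]; rewrite mem_index_iota => /andP[_ iz].
by case: eqP => // e; case/eqP: ir; apply/esym/(drop_target_inj rz' iz).
Qed.

Lemma s_zero n m : m != n.+1 -> m != n ->
  (forall r, (1 <= r <= (zeta d n).-1)%N ->
     m != (n - \sum_(1 <= j < r.+1) (d j).-1 * q d j.-1)%N) ->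
  s d p n m = 0.
Proof.
move=> /negPf mn1 /negPf mn h; rewrite /s mn1 mn big_nat_cond big1// => r.
by move=> /andP[rz]; rewrite /drop_target (negPf (h r _))//; lia.
Qed.

Hypothesis p01 : forall j, (1 <= j)%N -> 0 < p j <= 1.

Lemma s_ge0 n m : 0 <= s d p n m.
Proof.
have P0 a b : (1 <= a)%N -> 0 <= \prod_(a <= j < b) p j.
  move=> a1; rewrite big_nat_cond prodr_ge0// => j /andP[/andP[aj _] _].
  by have /andP[/ltW] := p01 (leq_trans a1 aj).
rewrite /s; case: ifP => _; first exact: P0.
case: ifP => _; first by rewrite subr_ge0; have /andP[] := @p01 1%N isT.
apply: sumr_ge0 => r _; rewrite mulr_ge0 ?P0// subr_ge0.
by have /andP[] := @p01 r.+1 isT.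
Qed.

Lemma s_row_sum n : \sum_(0 <= m < n.+2) s d p n m = 1.
Proof.
have [z1 _ _] := zetaP n.
rewrite !big_nat_recr//= s_up s_diag.
have -> : \sum_(0 <= m < n) s d p n m = \sum_(1 <= r < zeta d n)
    (1 - p r.+1) * \prod_(1 <= j < r.+1) p j.
  rewrite (eq_big_nat _ _ (F2 := fun m => \sum_(1 <= r < zeta d n)
     if m == drop_target d n r then
       (1 - p r.+1) * \prod_(1 <= j < r.+1) p j else 0)); last first.
    by move=> m /andP[_ mn]; rewrite /s !ltn_eqF ?(leq_trans mn)// -big_mkcond.
  rewrite exchange_big/=; apply: eq_big_nat => r rz.
  rewrite (bigD1_seq (drop_target d n r)) ?iota_uniq//= ?eqxx.
    by rewrite [X in _ + X]big1 ?addr0// => m /negPf ->.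
  by rewrite mem_index_iota drop_target_lt.
case: (zeta d n) z1 => // k _; elim: k => [|k IH].
  by rewrite big_nat1 big_geq//; ring.
rewrite big_nat_recr//= [X in _ + _ + X]big_nat_recr//= -[RHS]IH.
by ring.
Qed.

Lemma S_sum (w : nat -> R[i]) n :
  Sop d p w n = \sum_(0 <= m < n.+2) (s d p n m)%:C%C * w m.
Proof.
apply: (@lim_near_cst (R[i]^o : normedModType R[i]) (@norm_hausdorff _ _) _ \oo).
exists n.+2 => // N /= nN; rewrite /series /= (big_cat_nat _ nN)//=.
rewrite [X in _ + X]big_nat_cond [X in _ + X]big1 ?addr0// => m.
move=> /andP[/andP[nm _] _]; rewrite /s !gtn_eqF ?(ltnW nm)//.
rewrite big1 ?mul0r// => r /eqP E0.
by move: nm; rewrite E0 /drop_target; lia.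
Qed.

Lemma normc_S_le (w : nat -> R[i]) M n :
  (forall m, Normc.normc (w m) <= M) -> Normc.normc (Sop d p w n) <= M.
Proof.
move=> wM; rewrite S_sum -[leRHS]mul1r -(s_row_sum n) mulr_suml.
elim/big_ind2 : _ => [|x1 x2 y1 y2 h1 h2|m _]; first by rewrite Normc.normc0.
  by rewrite (le_trans (le_normcD _ _))// lerD.
rewrite Normc.normcM [X in X * _](_ : _ = s d p n m) ?ler_wpM2l ?s_ge0//.
by rewrite /= expr0n/= addr0 sqrtr_sqr ger0_norm ?s_ge0.
Qed.

Lemma normc_le_linf_norm (w : nat -> R[i]) n :
  linf w -> Normc.normc (w n) <= linf_norm w.
Proof.
move=> [M wM]; apply: ub_le_sup; last by exists n.
by exists M => _ [m _ <-].
Qed.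

Lemma S_bounded_operator : bounded_operator (Sop d p).
Proof.
split=> [w [M wM]|c u v _ _|].
- by exists M => n; exact: normc_S_le.
- apply/funext => n; rewrite !S_sum mulr_sumr -big_split/=.
  by apply: eq_bigr => m _; ring.
- exists 1 => w wl; rewrite mul1r; apply: ge_sup.
    by exists (Normc.normc (Sop d p w 0%N)), 0%N.
  move=> _ [n _ <-]; apply: normc_S_le => m.
  exact: normc_le_linf_norm.
Qed.

End matrix.
End digits.

(* Main.v *)
(* Write t = (z - (1 - p_1)) / p_1, so that f_1(z) = t ^ d_1. On the block
   {d_1 m, ..., d_1 m + d_1 - 1} the rows of (S - z) / p_1 act as
   u |-> u(n + 1) - t u(n), except the last one, which acts as
   (S' u_0)(m) - t u(n), where u_0(m) = u(d_1 m) and S' is the matrix of the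
   shifted sequences (d_(j+1)), (p_(j+1)). Eliminating the inner unknowns reduces
   S - z to S' - f_1(z). Since S' has norm at most 1, iterating shows that S - z is
   invertible as soon as some |f~_j(z)| > 1; the same recursion with zero right-hand
   side gives the eigenvector with entries prod_j iota_j ^ a_j(n), where
   iota_j ^ d_j = f~_j(z), and it is bounded when all |f~_j(z)| <= 1. Finally
   |f_j(y)| >= |y|^2 when |y| > 1, so E is the set where all |f~_j(z)| <= 1. *)

Require Import Defs.
From mathcomp Require Import all_boot all_order all_algebra.
From mathcomp Require Import all_classical all_reals all_analysis.
From mathcomp Require Import complex.
From mathcomp Require Import zify ring lra.

Set Implicit Arguments.
Unset Strict Implicit.
Unset Printing Implicit Defensive.

Import Order.TTheory GRing.Theory Num.Theory numFieldNormedType.Exports.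
Import Normc.

Local Open Scope ring_scope.

(** * Block structure of the rows of $S$ and the shifted sequences *)

(** The value 1 at index 0 restores the convention $d_0 = 1$, so that the facts on [q], [digit] and
    [zeta] apply again after a shift. *)
Definition shift_d (d : nat -> nat) (j : nat) : nat :=
  if j is _.+1 then d j.+1 else 1%N.

Definition shift_p (R : realType) (p : nat -> R) (j : nat) : R := p j.+1.

Section shift.
Variable d : nat -> nat.
Hypothesis d0 : d 0%N = 1%N.
Hypothesis d_ge2 : forall j, (1 <= j)%N -> (2 <= d j)%N.

Lemma shift_d_ge2 j : (1 <= j)%N -> (2 <= shift_d d j)%N.
Proof. by case: j => // j _; exact: d_ge2. Qed.

Lemma q_shift j : q d j.+1 = (d 1 * q (shift_d d) j)%N.
Proof.
elim: j => [|j IH]; first by rewrite qS !q0// mul1n muln1.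
by rewrite qS IH qS mulnA.
Qed.

Lemma digit1 m a : (a < d 1)%N -> digit d 1 (d 1 * m + a) = a.
Proof. by move=> ad; rewrite /digit /= q0// divn1 mulnC modnMDl modn_small. Qed.

Lemma digit_shift j m a : (a < d 1)%N ->
  digit d j.+2 (d 1 * m + a) = digit (shift_d d) j.+1 m.
Proof.
move=> ad; rewrite /digit /= q_shift divnMA mulnC divnMDl; last by lia.
by rewrite (divn_small ad) addn0.
Qed.

Lemma zeta_unique n k : (1 <= k)%N -> digit d k n != (d k).-1 ->
  (forall j, (1 <= j < k)%N -> digit d j n = (d j).-1) -> zeta d n = k.
Proof.
have [z1 z2 z3] := zetaP d0 d_ge2 n => k1 k2 k3.
case: (ltngtP (zeta d n) k) => // h.
  by move: z2; rewrite k3 ?eqxx// z1.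
by move: k2; rewrite z3 ?eqxx// k1.
Qed.

Lemma zeta_low m a : (a.+1 < d 1)%N -> zeta d (d 1 * m + a) = 1%N.
Proof. by move=> ad; apply: zeta_unique => //; [rewrite digit1; lia|lia]. Qed.

(** A maximal first digit forces a carry, which is then governed by the digits of [m]. *)
Lemma zeta_top m :
  zeta d (d 1 * m + (d 1).-1) = (zeta (shift_d d) m).+1.
Proof.
have [z1 z2 z3] := zetaP (erefl : shift_d d 0 = 1%N) shift_d_ge2 m.
have d1 := @d_ge2 1 isT.
apply: zeta_unique => //.
  by case: (zeta _ m) z1 z2 => // k _; rewrite digit_shift//; lia.
move=> [|[|j]] //; first by rewrite digit1//; lia.
by move=> jz; rewrite digit_shift ?z3//; lia.
Qed.

(** The first subtracted term clears the digit $d_1 - 1$; all later ones are multiples of $d_1$. *)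
Lemma drop_target_shift m r :
  drop_target d (d 1 * m + (d 1).-1) r.+1 = (d 1 * drop_target (shift_d d) m r)%N.
Proof.
rewrite /drop_target big_ltn// big_add1/= q0// muln1 mulnBr.
have -> : (\sum_(1 <= i < r.+1) (d i.+1).-1 * q d i =
   d 1 * \sum_(1 <= j < r.+1) (shift_d d j).-1 * q (shift_d d) j.-1)%N.
  rewrite big_distrr/= !big_nat; apply: eq_bigr => -[|i]// _.
  by rewrite q_shift/=; ring.
by lia.
Qed.

Section operator.
Variables (R : realType) (p : nat -> R).

Lemma S_row (w : nat -> R[i]) n : Sop d p w n =
  (\prod_(1 <= j < (zeta d n).+1) p j)%:C%C * w n.+1 + (1 - p 1%N)%:C%C * w n
  + \sum_(1 <= r < zeta d n)
      ((1 - p r.+1) * \prod_(1 <= j < r.+1) p j)%:C%C * w (drop_target d n r).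
Proof.
rewrite (S_sum d0) [in LHS]big_nat_recr//= [in LHS]big_nat_recr//= s_up s_diag.
rewrite [RHS]addrC [_%:C%C * w n.+1 + _]addrC addrA.
congr (_ + _ + _).
rewrite (eq_big_nat _ _ (F2 := fun m => \sum_(1 <= r < zeta d n)
   if m == drop_target d n r then
     ((1 - p r.+1) * \prod_(1 <= j < r.+1) p j)%:C%C * w m else 0)); last first.
  move=> m /andP[_ mn]; rewrite /s !ltn_eqF ?(leq_trans mn)// big_mkcond.
  rewrite raddf_sum mulr_suml; apply: eq_bigr => r _.
  by case: ifP => _; rewrite ?mul0r.
rewrite exchange_big/=; apply: eq_big_nat => r rz.
rewrite (bigD1_seq (drop_target d n r)) ?iota_uniq//= ?eqxx.
  by rewrite [X in _ + X]big1 ?addr0// => m /negPf ->.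
by rewrite mem_index_iota drop_target_lt.
Qed.

Lemma S_low (w : nat -> R[i]) m a : (a.+1 < d 1)%N ->
  Sop d p w (d 1 * m + a)%N =
  (p 1%N)%:C%C * w (d 1 * m + a.+1)%N + (1 - p 1%N)%:C%C * w (d 1 * m + a)%N.
Proof.
move=> ad; rewrite S_row zeta_low// big_nat1 [X in _ + X]big_geq// addr0.
by rewrite addnS.
Qed.

End operator.
End shift.

(** Off the diagonal this row only reaches multiples of $d_1$: the successor is $d_1(m+1)$, and
    every drop clears the first digit. *)
Lemma S_top (d : nat -> nat) (R : realType) (p : nat -> R) (w : nat -> R[i]) m :
  d 0%N = 1%N -> (forall j, (1 <= j)%N -> (2 <= d j)%N) ->
  Sop d p w (d 1 * m + (d 1).-1)%N =
  (1 - p 1%N)%:C%C * w (d 1 * m + (d 1).-1)%N +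
  (p 1%N)%:C%C * Sop (shift_d d) (shift_p p) (fun k => w (d 1 * k)%N) m.
Proof.
move=> d0 d_ge2; have d1 := d_ge2 1%N isT.
rewrite S_row// S_row//; last exact: shift_d_ge2.
rewrite zeta_top//.
have [z1 _ _] := zetaP (erefl : shift_d d 0 = 1%N) (shift_d_ge2 d_ge2) m.
have -> : ((d 1 * m + (d 1).-1).+1 = d 1 * m.+1)%N by lia.
have PE k : \prod_(1 <= j < k.+2) p j = p 1%N * \prod_(1 <= j < k.+1) shift_p p j.
  by rewrite big_ltn// big_add1.
(* The drop with $r = 1$ lands on $d_1 m$ with weight $p_1(1 - p_2)$, which is $p_1$ times the
   diagonal entry of the shifted matrix; later drops are the shifted drops. *)
rewrite PE [X in _ + _ + X = _]big_ltn// drop_target_shift//= big_nat1.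
rewrite [drop_target _ m 0](_ : _ = m); last by rewrite /drop_target big_geq// subn0.
rewrite [\sum_(2 <= i < _) _]big_add1/=.
rewrite !mulrDr mulr_sumr.
rewrite (eq_big_nat _ _ (F2 := fun r => (p 1%N)%:C%C *
   (((1 - shift_p p r.+1) * \prod_(1 <= j < r.+1) shift_p p j)%:C%C *
    w (d 1 * drop_target (shift_d d) m r)%N))); last first.
  move=> r _; rewrite PE drop_target_shift// /shift_p !rmorphM/=; ring.
rewrite /shift_p !rmorphM/=; ring.
Qed.

(** * Modulus estimates and tails of geometrically bounded series *)

Section normc.
Variable R : realType.
Implicit Types (z : R[i]) (x : R).

Lemma normc_ge0 z : 0 <= normc z.
Proof. by case: z => a b; exact: sqrtr_ge0. Qed.

Lemma normc_real x : normc x%:C%C = `|x|.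
Proof. by rewrite /= expr0n/= addr0 sqrtr_sqr. Qed.

Lemma normcX z n : normc (z ^+ n) = normc z ^+ n.
Proof.
elim: n => [|n IH]; first by rewrite !expr0 normc1.
by rewrite !exprS normcM IH.
Qed.

Lemma normc_le_ReIm (a b : R) : normc (a +i* b)%C <= `|a| + `|b|.
Proof.
rewrite /= -[leRHS]ger0_norm ?addr_ge0// -sqrtr_sqr ler_wsqrtr//.
rewrite -(real_normK (num_real a)) -(real_normK (num_real b)).
have := normr_ge0 a; have := normr_ge0 b; nra.
Qed.

Lemma Re_le_normc z : `|complex.Re z| <= normc z.
Proof. by case: z => a b /=; rewrite -sqrtr_sqr ler_wsqrtr// lerDl sqr_ge0. Qed.

Lemma Im_le_normc z : `|complex.Im z| <= normc z.
Proof. by case: z => a b /=; rewrite -sqrtr_sqr ler_wsqrtr// lerDr sqr_ge0. Qed.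

Lemma normcB_ge z1 z2 : normc z1 - normc z2 <= normc (z1 - z2).
Proof. by rewrite lerBlDr (le_trans _ (le_normcD _ _))// subrK. Qed.

Lemma le0_of_geometric_bound (x C r : R) : 0 <= r < 1 ->
  (forall k, x <= C * r ^+ k) -> x <= 0.
Proof.
move=> /andP[r0 r1] xC.
have := @cvg_geometric R C r; rewrite ger0_norm// => /(_ r1) cvg0.
rewrite -(cvg_lim _ cvg0)//; apply: limr_ge; first by apply/cvg_ex; exists 0.
by near=> k; exact: xC.
Unshelve. all: by end_near. Qed.

Lemma geometric_tail_real (x : nat -> R) M r : 0 <= r < 1 ->
  (forall k, `|x k| <= M * r ^+ k) ->
  exists l, forall n, `|l - \sum_(0 <= k < n) x k| <= M / (1 - r) * r ^+ n.
Proof.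
move=> /andP[r0 r1] xM.
have cx : cvgn (series x).
  apply: normed_cvg; apply: (@series_le_cvg _ _ (geometric M r)) => //.
  - by move=> k /=; exact: normr_ge0.
  - by move=> k; exact: le_trans (normr_ge0 _) (xM k).
  - by apply: is_cvg_geometric_series; rewrite ger0_norm.
exists (limn (series x)) => n.
have r1' : 0 < 1 - r by lra.
have M0 : 0 <= M by have := le_trans (normr_ge0 _) (xM 0%N); rewrite expr0 mulr1.
(* With the factor $1 - r^k$ the bound is the exact finite geometric sum, so the induction closes;
   the factor is dropped at the end. *)
have tail k : `|series x (n + k)%N - series x n| <=
    M / (1 - r) * r ^+ n * (1 - r ^+ k).
  elim: k => [|k IH]; first by rewrite addn0 subrr normr0 expr0 subrr mulr0.
  rewrite addnS /series /= big_nat_recr//= -/(series x _) addrAC.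
  rewrite (le_trans (ler_normD _ _))//.
  apply: le_trans (lerD IH (xM _)) _.
  rewrite exprS exprD le_eqVlt; apply/orP; left; apply/eqP; field.
  by rewrite gt_eqF.
have cxn : (`|series x k - series x n| @[k --> \oo] -->
    `|limn (series x) - series x n|)%classic.
  by apply: cvg_norm; apply: cvgB => //; exact: cvg_cst.
rewrite -[X in X <= _](cvg_lim _ cxn)//.
apply: limr_le; first by apply/cvg_ex; eexists; exact: cxn.
near=> k.
have nk : (n <= k)%N by near: k; exact: nbhs_infty_ge.
rewrite -(subnKC nk) (le_trans (tail _))// -[leRHS]mulr1 ler_wpM2l//.
  by rewrite mulr_ge0 ?exprn_ge0// divr_ge0// ltW.
by rewrite lerBlDr lerDl exprn_ge0.
Unshelve. all: by end_near. Qed.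

(** The factor 2 comes from adding the estimates for real and imaginary parts. *)
Lemma geometric_tail (c : nat -> R[i]) M r : 0 <= r < 1 ->
  (forall k, normc (c k) <= M * r ^+ k) ->
  exists l, forall n,
    normc (l - \sum_(0 <= k < n) c k) <= 2 * (M / (1 - r)) * r ^+ n.
Proof.
move=> r01 cM.
have [a aP] := geometric_tail_real (x := fun k => complex.Re (c k)) r01
  (fun k => le_trans (Re_le_normc _) (cM k)).
have [b bP] := geometric_tail_real (x := fun k => complex.Im (c k)) r01
  (fun k => le_trans (Im_le_normc _) (cM k)).
exists (a +i* b)%C => n.
have -> : \sum_(0 <= k < n) c k = ((\sum_(0 <= k < n) complex.Re (c k)) +i*
    (\sum_(0 <= k < n) complex.Im (c k)))%C.
  elim: n {aP bP} => [|n IH]; first by rewrite !big_geq.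
  by rewrite !big_nat_recr//= IH; case: (c n).
apply: le_trans (normc_le_ReIm _ _) _.
apply: le_trans (lerD (aP n) (bP n)) _.
by rewrite -mulrDl -mulr2n mulr_natl.
Qed.

End normc.

(* Surjectivity comes with the bound on the solution, so that the inverse is
   automatically bounded. *)
Definition boundedly_bijective (R : realType)
    (A : (nat -> R[i]) -> nat -> R[i]) : Prop :=
  (exists K : R, forall v M, (forall n, normc (v n) <= M) ->
     exists2 u, A u = v & forall n, normc (u n) <= K * M) /\
  (forall u, linf u -> A u = (fun=> 0) -> u = (fun=> 0)).

(** * Bounded inverses and the Neumann series for $|z| > 1$ *)

Section resolvent.
Variables (R : realType) (p : nat -> R) (d : nat -> nat).
Hypothesis p01 : forall j, (1 <= j)%N -> 0 < p j <= 1.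
Hypothesis d0 : d 0%N = 1%N.
Hypothesis d_ge2 : forall j, (1 <= j)%N -> (2 <= d j)%N.

Lemma SopD (c : R[i]) u v n :
  Sop d p (fun n => c * u n + v n) n = c * Sop d p u n + Sop d p v n.
Proof.
rewrite !(S_sum d0) mulr_sumr -big_split/=.
by apply: eq_bigr => m _; ring.
Qed.

Lemma sub_scalarD (z c : R[i]) u v :
  sub_scalar (Sop d p) z (fun n => c * u n + v n) =
  (fun n => c * sub_scalar (Sop d p) z u n + sub_scalar (Sop d p) z v n).
Proof. by apply/funext => n; rewrite /sub_scalar SopD; ring. Qed.

Lemma linfD (c : R[i]) (u v : nat -> R[i]) :
  linf u -> linf v -> linf (fun n => c * u n + v n).
Proof.
move=> [M uM] [N vN]; exists (normc c * M + N) => n.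
rewrite (le_trans (le_normcD _ _))// lerD// normcM.
by rewrite ler_wpM2l ?normc_ge0.
Qed.

Lemma boundedly_bijective_invertible (z : R[i]) :
  boundedly_bijective (sub_scalar (Sop d p) z) ->
  invertible_linf (sub_scalar (Sop d p) z).
Proof.
move=> [[K surj] inj].
set A := sub_scalar (Sop d p) z in surj inj *.
have Alinf u : linf u -> linf (A u).
  move=> [M uM]; exists (M + normc z * M) => n.
  rewrite /A /sub_scalar (le_trans (le_normcD _ _))// lerD//.
    exact: (normc_S_le d0 d_ge2 p01).
  by rewrite normcN normcM ler_wpM2l ?normc_ge0.
have inj2 u v : linf u -> linf v -> A u = A v -> u = v.
  move=> lu lv Auv; have /inj : linf (fun n => -1 * u n + v n) by exact: linfD.
  rewrite /A sub_scalarD -/A Auv => H.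
  have {}/H : (fun n => -1 * A v n + A v n) = (fun=> 0 : R[i]).
    by apply/funext => n; ring.
  by move=> /funeqP H; apply/funext => n; have := H n => /= {}H; 
     apply/esym/eqP; rewrite -subr_eq0 -H; apply/eqP; ring.
(* One [u] must serve every bound [M] of [v]: injectivity identifies the solutions supplied for
   different bounds. Outside [linf] the value is arbitrary. *)
have ex v : exists u, linf v -> A u = v /\
    forall M, (forall n, normc (v n) <= M) -> forall n, normc (u n) <= K * M.
  have [[M vM]|nv] := pselect (linf v); last by exists v.
  have [u Au uM] := surj _ _ vM.
  exists u => _; split => // N vN; have [u' Au' uN] := surj _ _ vN.
  suff -> : u = u' by [].
  by apply: inj2; [exists (K * M)|exists (K * N)|rewrite Au Au'].
have [B BP] := choice ex.
have Blinf v : linf v -> linf (B v).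
  move=> lv; have [_ h] := BP _ lv; case: (lv) => M /h BM.
  by exists (K * M).
exists B; split.
  split=> [//|c u v lu lv|].
    apply: inj2; [exact/Blinf/linfD|exact: linfD (Blinf _ lu) (Blinf _ lv)|].
    rewrite /A sub_scalarD -/A.
    have [-> _] := BP _ (linfD c lu lv).
    by have [-> _] := BP _ lu; have [-> _] := BP _ lv.
  exists K => w lw; apply: ge_sup; first by exists (normc (B w 0%N)), 0%N.
  move=> _ [n _ <-]; have [_] := BP _ lw; apply=> m.
  exact: normc_le_linf_norm.
move=> w lw; split; last by have [] := BP _ lw.
apply: inj2 => //; first exact/Blinf/Alinf.
by have [] := BP _ (Alinf _ lw).
Qed.

(** Since $S$ does not increase sup bounds, $u = -\sum_k z^{-k-1} S^k v$ converges geometrically.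
    For injectivity, $Su = zu$ improves any bound on $u$ by the factor $1/|z|$, repeatedly. *)
Lemma boundedly_bijective_large (z : R[i]) :
  1 < normc z -> boundedly_bijective (sub_scalar (Sop d p) z).
Proof.
move=> z1.
have zn0 : z != 0.
  by apply: contraTneq z1 => ->; rewrite normc0 -leNgt.
have nz0 : 0 < normc z by exact: lt_trans z1.
set r := (normc z)^-1.
have r0 : 0 <= r by rewrite invr_ge0 ltW.
have r01 : 0 <= r < 1 by rewrite r0 invf_lt1.
split.
  exists (2 * (r / (1 - r))) => v M vM.
  pose c n k := - (z^-1 ^+ k.+1 * iter k (Sop d p) v n).
  have SM k n : normc (iter k (Sop d p) v n) <= M.
    by elim: k n => [//|k IH] n /=; exact: (normc_S_le d0 d_ge2 p01).
  have cM n k : normc (c n k) <= r * M * r ^+ k.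
    rewrite normcN normcM normcX normcV -/r exprS.
    by rewrite [leRHS]mulrAC ler_wpM2l ?mulr_ge0 ?exprn_ge0.
  have [u uP] := choice (fun n => geometric_tail r01 (cM n)).
  have M0 : 0 <= M := le_trans (normc_ge0 _) (vM 0%N).
  exists u; last first.
    move=> n; have := uP n 0%N; rewrite big_geq// subr0 expr0 mulr1.
    by rewrite [r * M / _]mulrAC !mulrA.
  pose U K n := \sum_(0 <= k < K) c n k.
  have UE K n : sub_scalar (Sop d p) z (U K) n =
      v n - z^-1 ^+ K * iter K (Sop d p) v n.
    elim: K => [|K IH].
      have -> : U 0%N = (fun=> 0) by apply/funext => k; exact: big_geq.
      rewrite /sub_scalar (S_sum d0) mulr0 subr0 expr0 mul1r subrr.
      by apply: big1 => m _; rewrite mulr0.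
    have -> : U K.+1 = (fun n => - z^-1 ^+ K.+1 * iter K (Sop d p) v n + U K n).
      by apply/funext => k; rewrite /U big_nat_recr//= addrC /c mulNr.
    rewrite sub_scalarD IH /sub_scalar /= exprS; field.
    exact: zn0.
  apply/funext => n; apply/eqP; rewrite -subr_eq0; apply/eqP/eq0_normc/eqP.
  rewrite eq_le normc_ge0 andbT.
  set D := 2 * (r * M / (1 - r)).
  (* Up to the factor $r^K$, [D] bounds $S(u - U_K)$, $|z| D$ bounds $z(u - U_K)$, and [M] bounds
     the telescoping remainder. *)
  apply: (@le0_of_geometric_bound _ _ (D + normc z * D + M) _ r01) => K.
  have -> : sub_scalar (Sop d p) z u n - v n =
      Sop d p (fun m => -1 * U K m + u m) n +
      (- z * (u n - U K n) - z^-1 ^+ K * iter K (Sop d p) v n).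
    have := UE K n; rewrite SopD /sub_scalar => E.
    have -> : v n = Sop d p (U K) n - z * U K n + z^-1 ^+ K * iter K (Sop d p) v n.
      by rewrite E; ring.
    by ring.
  rewrite (le_trans (le_normcD _ _))// -addrA mulrDl lerD//.
    apply: (normc_S_le d0 d_ge2 p01) => m.
    by rewrite mulN1r addrC; exact: uP.
  rewrite (le_trans (le_normcD _ _))// mulrDl lerD//.
    rewrite normcM normcN -mulrA ler_wpM2l ?normc_ge0//.
    exact: uP.
  rewrite normcN normcM normcX normcV -/r mulrC ler_wpM2r ?exprn_ge0//.
move=> u [M uM] Au.
have Su : Sop d p u = (fun n => z * u n).
  by apply/funext => n; have /funeqP/(_ n)/eqP := Au; rewrite subr_eq0 => /eqP.
apply/funext => n; apply/eq0_normc/eqP; rewrite eq_le normc_ge0 andbT.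
apply: (@le0_of_geometric_bound _ _ M _ r01) => k.
elim: k n => [|k IH] n; first by rewrite expr0 mulr1.
have : normc (Sop d p u n) <= M * r ^+ k by exact: (normc_S_le d0 d_ge2 p01).
rewrite Su normcM exprSr mulrA -ler_pdivlMl// mulrC.
by rewrite -/r mulrC.
Qed.

End resolvent.

(** * Elimination of the inner unknowns of a block *)

(** The ratio $t$ of neighbouring entries, inside a block, of a solution of $(S - z)u = 0$. *)
Definition affine1 (R : realType) (p : nat -> R) (z : R[i]) : R[i] :=
  (z - (1 - p 1%N)%:C%C) / (p 1%N)%:C%C.

(** The inner rows of $(S - z)u = v$ read $u(n+1) = t u(n) + v(n)/p_1$; this propagates the first
    entry $x$ of a block, with $y = v/p_1$. *)
Fixpoint affine_orbit (K : pzRingType) (t : K) (y : nat -> K) (x : K) (a : nat) : K :=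
  if a is b.+1 then t * affine_orbit t y x b + y b else x.

(** Isolates the dependence on $x$: over a full block its coefficient is $t^{d_1} = f_1(z)$, the new
    spectral parameter. *)
Lemma affine_orbitE (K : pzRingType) (t : K) y x a :
  affine_orbit t y x a = t ^+ a * x + affine_orbit t y 0 a.
Proof.
elim: a => [|a IH] /=; first by rewrite expr0 mul1r addr0.
by rewrite IH mulrDr mulrA exprS addrA.
Qed.

Lemma affine_orbit_bound (R : realType) (t : R[i]) y x a N :
  normc x <= N -> (forall i, normc (y i) <= N) ->
  normc (affine_orbit t y x a) <= (1 + normc t) ^+ a * N.
Proof.
move=> xN yN; have t0 := normc_ge0 t.
have N0 : 0 <= N := le_trans (normc_ge0 _) xN.
elim: a => [|a IH] /=; first by rewrite expr0 mul1r.
rewrite (le_trans (le_normcD _ _))// normcM exprS mulrDl mul1r mulrDl addrC.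
rewrite lerD ?(le_trans (yN a))//; last by rewrite -mulrA ler_wpM2l.
by rewrite ler_peMl// exprn_ege1// lerDl.
Qed.

Lemma divn_mulD d m a : (a < d)%N -> ((d * m + a) %/ d = m)%N.
Proof. by move=> ad; rewrite mulnC divnMDl; [rewrite divn_small// addn0|lia]. Qed.

Lemma modn_mulD d m a : (a < d)%N -> ((d * m + a) %% d = a)%N.
Proof. by move=> ad; rewrite mulnC modnMDl modn_small. Qed.

Lemma block_ind d (P : nat -> Prop) : (1 < d)%N ->
  (forall m a, (a.+1 < d)%N -> P (d * m + a)%N) ->
  (forall m, P (d * m + d.-1)%N) -> forall n, P n.
Proof.
move=> d1 low top n; have md : (n %% d < d)%N by rewrite ltn_mod; lia.
rewrite (divn_eq n d) mulnC.
have [h|h] := ltnP (n %% d).+1 d; first exact: low.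
by have -> : (n %% d = d.-1)%N by lia.
Qed.

Section reduction.
Variables (R : realType) (p : nat -> R) (d : nat -> nat).
Hypothesis p01 : forall j, (1 <= j)%N -> 0 < p j <= 1.
Hypothesis d0 : d 0%N = 1%N.
Hypothesis d_ge2 : forall j, (1 <= j)%N -> (2 <= d j)%N.

Lemma p1_neq0 : (p 1%N)%:C%C != 0 :> R[i].
Proof. by have /andP[/gt_eqF p1 _] := @p01 1%N isT; rewrite eq_complex /= p1. Qed.

Lemma sub_scalar_low (z : R[i]) w m a : (a.+1 < d 1)%N ->
  sub_scalar (Sop d p) z w (d 1 * m + a)%N =
  (p 1%N)%:C%C * (w (d 1 * m + a.+1)%N - affine1 p z * w (d 1 * m + a)%N).
Proof.
by move=> ad; rewrite /sub_scalar S_low// /affine1; field; exact: p1_neq0.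
Qed.

Lemma sub_scalar_top (z : R[i]) w m :
  sub_scalar (Sop d p) z w (d 1 * m + (d 1).-1)%N =
  (p 1%N)%:C%C * (Sop (shift_d d) (shift_p p) (fun k => w (d 1 * k)%N) m -
                  affine1 p z * w (d 1 * m + (d 1).-1)%N).
Proof. by rewrite /sub_scalar S_top// /affine1; field; exact: p1_neq0. Qed.

Lemma affine1X (z : R[i]) : affine1 p z ^+ d 1 = fj d p 1 z.
Proof. by []. Qed.

(* Schur complement: on each block {d_1 m, ..., d_1 m + d_1 - 1} the equation
   (S - z) u = v determines u from u(d_1 m), and what remains is an equation for
   m |-> u(d_1 m) governed by the shifted operator minus f_1(z). *)
Lemma boundedly_bijective_shift (z : R[i]) :
  boundedly_bijective
    (sub_scalar (Sop (shift_d d) (shift_p p)) (fj d p 1 z)) ->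
  boundedly_bijective (sub_scalar (Sop d p) z).
Proof.
set t := affine1 p z; set P := (p 1%N)%:C%C.
have Pn0 : P != 0 := p1_neq0.
have d1 := @d_ge2 1%N isT.
have d1S : (d 1 = (d 1).-1.+1)%N by lia.
have p1 : 0 < p 1%N by have /andP[] := @p01 1%N isT.
set B := 1 + normc t.
have B1 : 1 <= B by rewrite lerDl normc_ge0.
move=> [[K surj] inj]; split.
  (* The inner $B^{d_1}$ bounds the reduced data, the $+1$ dominates $v/p_1$ itself, and the outer
     $B^{d_1}$ pays for propagation through a block. [K] may be negative, hence its absolute
     value. *)
  exists (B ^+ d 1 * ((`|K| * B ^+ d 1 + 1) / p 1%N)) => v M vM.
  have M0 : 0 <= M := le_trans (normc_ge0 _) (vM 0%N).
  pose y m i := v (d 1 * m + i)%N / P.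
  have yM m i : normc (y m i) <= M / p 1%N.
    by rewrite normcM normcV normc_real gtr0_norm// ler_pM2r ?invr_gt0.
  have Mp0 : 0 <= M / p 1%N by rewrite divr_ge0// ltW.
  (* The reduced right-hand side is what $v$ contributes over one full block started from 0. *)
  have [u0 Eu0 u0K] := surj (fun m => affine_orbit t (y m) 0 (d 1))
    (B ^+ d 1 * (M / p 1%N))
    (fun m => affine_orbit_bound _ _ (eq_ind_r (fun x => x <= _) Mp0 (normc0 R)) (yM m)).
  pose u n := affine_orbit t (y (n %/ d 1)%N) (u0 (n %/ d 1)%N) (n %% d 1).
  have uE m a : (a < d 1)%N -> u (d 1 * m + a)%N = affine_orbit t (y m) (u0 m) a.
    by move=> ad; rewrite /u divn_mulD// modn_mulD.
  have u0E : (fun k => u (d 1 * k)%N) = u0.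
    by apply/funext => k; rewrite -[(d 1 * k)%N]addn0 uE//; lia.
  exists u.
    apply/funext; apply: (block_ind d1) => [m a ad|m].
      rewrite sub_scalar_low// !uE/=; try lia.
      by rewrite -/t /y -/P; field.
    (* By the reduced equation, $S' u_0$ is the value that the recursion gives one place past the
       block. *)
    have Su0 : Sop (shift_d d) (shift_p p) u0 m =
        affine_orbit t (y m) (u0 m) (d 1).
      move: Eu0 => /funeqP/(_ m)/eqP.
      by rewrite /sub_scalar subr_eq addrC -affine1X -affine_orbitE => /eqP.
    rewrite sub_scalar_top u0E Su0 uE; last by lia.
    rewrite {1}d1S /= -/t -/P /y; field.
    exact: Pn0.
  move=> n; set N := (`|K| * B ^+ d 1 + 1) * (M / p 1%N).
  have BX a : 1 <= B ^+ a by exact: exprn_ege1.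
  have KB0 : 0 <= `|K| * B ^+ d 1 by rewrite mulr_ge0// (le_trans ler01).
  have NM : M / p 1%N <= N by rewrite /N ler_peMl// lerDr.
  have N0 : 0 <= N := le_trans Mp0 NM.
  have uN : normc (u n) <= B ^+ (n %% d 1) * N.
    apply: affine_orbit_bound => [|i]; last exact: le_trans (yM _ _) NM.
    apply: le_trans (u0K _) _; rewrite [leLHS]mulrA ler_wpM2r//.
    apply: (@le_trans _ _ (`|K| * B ^+ d 1)); last by rewrite lerDl.
    by rewrite ler_wpM2r ?ler_norm// (le_trans ler01).
  apply: le_trans uN _.
  have -> : B ^+ d 1 * ((`|K| * B ^+ d 1 + 1) / p 1%N) * M = B ^+ d 1 * N.
    by rewrite /N; field; rewrite gt_eqF.
  rewrite ler_wpM2r//.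
  by rewrite ler_weXn2l// ltnW// ltn_mod; lia.
move=> u [M uM] /funeqP Su.
(* With zero data each block is a geometric progression of ratio $t$. *)
have ulow m a : (a < d 1)%N -> u (d 1 * m + a)%N = t ^+ a * u (d 1 * m)%N.
  elim: a => [|a IH] ad; first by rewrite addn0 mul1r.
  have /eqP := Su (d 1 * m + a)%N; rewrite sub_scalar_low// mulf_eq0 (negPf Pn0)/=.
  by rewrite subr_eq0 => /eqP ->; rewrite IH ?exprS ?mulrA// ltnW.
have u00 : (fun k => u (d 1 * k)%N) = (fun=> 0).
  apply: inj; first by exists M.
  apply/funext => m; rewrite /sub_scalar -affine1X -/t.
  have /eqP := Su (d 1 * m + (d 1).-1)%N.
  rewrite sub_scalar_top mulf_eq0 (negPf Pn0)/= ulow; last by lia.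
  by rewrite mulrA -exprS -d1S => /eqP.
apply/funext => n; rewrite (divn_eq n (d 1)) mulnC ulow ?ltn_mod; last by lia.
by have /funeqP/(_ (n %/ d 1)%N) := u00 => ->; rewrite mulr0.
Qed.

End reduction.

(** * Iteration over shifts, the eigenvector, and the set $E$ *)

Section eigenvector.
Variable R : realType.

(** [ftilde] recurses on the outermost map, while induction over shifts needs the innermost one
    split off. *)
Lemma ftilde_shift (d : nat -> nat) (p : nat -> R) j (z : R[i]) :
  ftilde d p j.+1 z = ftilde (shift_d d) (shift_p p) j (fj d p 1 z).
Proof. by elim: j => // j IH; rewrite [LHS]/= -/(ftilde d p j.+1 z) IH. Qed.

(** After [j] eliminations the spectral parameter is $\tilde f_j(z)$, where the Neumann series
    applies. *)
Lemma boundedly_bijective_ftilde j (d : nat -> nat) (p : nat -> R) (z : R[i]) :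
  (forall j, (1 <= j)%N -> 0 < p j <= 1) ->
  d 0%N = 1%N -> (forall j, (1 <= j)%N -> (2 <= d j)%N) ->
  1 < normc (ftilde d p j z) -> boundedly_bijective (sub_scalar (Sop d p) z).
Proof.
elim: j d p z => [|j IH] d p z p01 d0 d_ge2.
  exact: boundedly_bijective_large.
rewrite ftilde_shift => h; apply: boundedly_bijective_shift => //.
by apply: IH h => // i i1; [exact: p01|exact: shift_d_ge2].
Qed.

(* The product of the iota_j ^ a_j(n) over j <= k; all factors beyond the first n
   digits are 1, so k = n gives the full product. *)
Fixpoint digit_prod k (d : nat -> nat) (p : nat -> R) (z : R[i]) n : R[i] :=
  if k is k'.+1 then affine1 p z ^+ (n %% d 1)%N *
    digit_prod k' (shift_d d) (shift_p p) (fj d p 1 z) (n %/ d 1)%N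
  else 1.

Definition eigenvector d p (z : R[i]) n := digit_prod n d p z n.

Lemma digit_prod0 k d p z : digit_prod k d p z 0 = 1.
Proof.
by elim: k d p z => //= k IH d p z; rewrite mod0n div0n IH expr0 mulr1.
Qed.

Lemma digit_prod_stable k d p z n : (forall j, (1 <= j)%N -> (2 <= d j)%N) ->
  (n <= k)%N -> digit_prod k d p z n = eigenvector d p z n.
Proof.
have step l : forall d p z n, (forall j, (1 <= j)%N -> (2 <= d j)%N) ->
    (n <= l)%N -> digit_prod l.+1 d p z n = digit_prod l d p z n.
  elim: l => [|l IH] {}d {}p {}z {}n d_ge2 nl.
    by move: nl; rewrite leqn0 => /eqP ->; rewrite !digit_prod0.
  rewrite [LHS]/= -/(digit_prod l.+1 _ _ _ _) IH//; first exact: shift_d_ge2.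
  (* The depth stays sufficient after a shift because $\lfloor n/d_1 \rfloor < n$ unless $n = 0$. *)
  have [->|n0] := posnP n; first by rewrite div0n.
  by rewrite -ltnS (leq_trans _ nl)// ltn_Pdiv// d_ge2.
move=> d_ge2; elim: k => [|k IH]; first by rewrite leqn0 => /eqP ->.
rewrite leq_eqVlt => /predU1P[-> //|nk].
by rewrite step// IH.
Qed.

Lemma eigenvectorE d p z m a : (forall j, (1 <= j)%N -> (2 <= d j)%N) ->
  (a < d 1)%N -> eigenvector d p z (d 1 * m + a)%N =
  affine1 p z ^+ a * eigenvector (shift_d d) (shift_p p) (fj d p 1 z) m.
Proof.
move=> d_ge2 ad; have d1 := d_ge2 1%N isT.
(* One extra level lets the first factor be split off; the remaining depth $d_1 m + a$ is still at
   least $m$. *)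
rewrite -(@digit_prod_stable (d 1 * m + a).+1%N)// /=.
rewrite divn_mulD// modn_mulD// digit_prod_stable//; first exact: shift_d_ge2.
nia.
Qed.

(** Strong induction on [n] over all sequences at once: inner rows vanish because blocks are
    geometric progressions, and the last row of block $m < n$ reduces to row $m$ for the shifted
    data. *)
Lemma eigenvectorP d p z n :
  (forall j, (1 <= j)%N -> 0 < p j <= 1) ->
  d 0%N = 1%N -> (forall j, (1 <= j)%N -> (2 <= d j)%N) ->
  Sop d p (eigenvector d p z) n = z * eigenvector d p z n.
Proof.
elim/ltn_ind: n d p z => n + d p z p01 d0 d_ge2; have d1 := d_ge2 1%N isT.
move=> IH; apply/eqP; rewrite -subr_eq0; apply/eqP.
rewrite -[LHS]/(sub_scalar (Sop d p) z (eigenvector d p z) n).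
move: n IH; apply: (block_ind d1) => [m a ad _|m IH].
  rewrite sub_scalar_low// !eigenvectorE//; last exact: ltnW.
  by rewrite exprS mulrA subrr mulr0.
rewrite sub_scalar_top// eigenvectorE//; last by lia.
have -> : (fun k => eigenvector d p z (d 1 * k)%N) =
    eigenvector (shift_d d) (shift_p p) (fj d p 1 z).
  apply/funext => k; rewrite -[(d 1 * k)%N]addn0 eigenvectorE ?mul1r//; lia.
rewrite IH//; [|nia|by move=> j j1; exact: p01|exact: shift_d_ge2].
rewrite mulrA -exprS prednK; last by lia.
by rewrite affine1X subrr mulr0.
Qed.

(** Each factor is a power of a $d_j$-th root of $\tilde f_j(z)$, hence of modulus at most 1. *)
Lemma eigenvector_le1 d p (z : R[i]) n :
  (forall j, (1 <= j)%N -> (2 <= d j)%N) ->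
  (forall j, normc (ftilde d p j z) <= 1) -> normc (eigenvector d p z n) <= 1.
Proof.
(* The depth is decoupled from [n]: a shift lowers it by one but replaces [n] by a quotient. *)
rewrite /eigenvector; move: {1}n => k.
elim: k d p z n => [|k IH] d p z n d_ge2 fle1.
  by rewrite [digit_prod _ _ _ _ _]/= normc1.
have d1 := d_ge2 1%N isT.
rewrite [digit_prod _ _ _ _ _]/= normcM mulr_ile1 ?normc_ge0//; last first.
  by apply: IH => [|j]; [exact: shift_d_ge2|rewrite -ftilde_shift].
have : normc (affine1 p z ^+ d 1) <= 1 := fle1 1%N.
rewrite !normcX => h.
rewrite exprn_ile1 ?normc_ge0//.
by rewrite -(@expr_le1 _ (d 1)) ?normc_ge0// ltnW.
Qed.

(** For $|y| > 1$, $|y - (1 - p_j)| \ge |y| - (1 - p_j) \ge p_j |y|$; then $d_j \ge 2$ gives the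
    square. *)
Lemma fj_expanding (d : nat -> nat) (p : nat -> R) j (y : R[i]) :
  0 < p j <= 1 -> (2 <= d j)%N -> 1 < normc y ->
  normc y ^+ 2 <= normc (fj d p j y).
Proof.
move=> /andP[p0 p1] d2 y1; rewrite /fj normcX.
have h : normc y <= normc ((y - (1 - p j)%:C%C) / (p j)%:C%C).
  rewrite normcM normcV normc_real gtr0_norm// ler_pdivlMr//.
  apply: le_trans (normcB_ge _ _); rewrite normc_real ger0_norm ?subr_ge0//.
  nra.
apply: le_trans (lerXn2r 2 _ _ h) _; rewrite ?nnegrE ?normc_ge0//.
by rewrite ler_weXn2l// (le_trans (ltW y1)).
Qed.

Lemma EsetP d p (z : R[i]) :
  (forall j, (1 <= j)%N -> 0 < p j <= 1) ->
  (forall j, (1 <= j)%N -> (2 <= d j)%N) ->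
  Eset d p z <-> forall j, normc (ftilde d p j z) <= 1.
Proof.
move=> p01 d_ge2; split => [zE j|fle1]; last first.
  apply: (@le_lt_trans _ _ 1%:E); last exact: ltry.
  rewrite limn_esup_lim; apply: lime_le; first exact: is_cvg_esups.
  near=> n; apply: ge_ereal_sup => _ [k _ <-].
  by rewrite lee_fin.
rewrite leNgt; apply/negP => fj1; set x := normc _ in fj1.
have x0 : 0 <= x by exact: normc_ge0.
(* Squaring gives much faster growth, but one extra factor [x] per step already forces
   divergence. *)
have grow k : x ^+ k.+1 <= normc (ftilde d p (j + k) z).
  elim: k => [|k IH]; first by rewrite addn0 expr1.
  have y1 : 1 < normc (ftilde d p (j + k) z).
    by apply: lt_le_trans IH; rewrite exprn_egt1.
  rewrite addnS /=; apply: le_trans (fj_expanding _ _ y1); rewrite ?p01 ?d_ge2//.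
  rewrite exprSr expr2 ler_pM ?exprn_ge0//.
  by apply: le_trans IH; rewrite exprS ler_peMr// exprn_ege1// ltW.
have x1 : `|x^-1| < 1 by rewrite ger0_norm ?invr_ge0// invf_lt1// (lt_trans ltr01).
have xoo : (x ^+ k @[k --> \oo] --> +oo)%classic.
  apply/gtr0_cvgV0; first by apply: nearW => k; rewrite exprn_gt0// (lt_trans ltr01).
  rewrite [X in (X @ _)%classic](_ : _ = GRing.exp x^-1); first exact: cvg_expr.
  by apply/funext => k; rewrite /= exprVn.
have : ((normc (ftilde d p k z))%:E @[k --> \oo] --> +oo%E)%classic.
  apply/cvgeyPge => A; move: xoo => /cvgryPge/(_ A)[N _ NA].
  exists (j + N)%N => // k /= jNk.
  rewrite lee_fin -(subnKC (leq_trans (leq_addr N j) jNk)).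
  by apply: le_trans (grow _); apply: NA => /=; lia.
move=> ftilde_oo; move: zE; rewrite /Eset /= (is_cvg_limn_esupE (cvgP _ ftilde_oo)).
by rewrite (cvg_lim _ ftilde_oo).
Unshelve. all: by end_near. Qed.

End eigenvector.

(** * Conclusion by the cycle $E \subseteq \sigma_p \subseteq \sigma \subseteq E$ *)

Theorem theorem3p3 (R : realType) (p : nat -> R) (d : nat -> nat)
    (hp : forall j : nat, (1 <= j)%N -> 0 < p j <= 1)
    (hd0 : d 0%N = 1%N)
    (hd : forall j : nat, (1 <= j)%N -> (2 <= d j)%N) :
  Eset d p = spectrum (Sop d p) /\ spectrum (Sop d p) = point_spectrum (Sop d p).
Proof.
have EP : (Eset d p `<=` point_spectrum (Sop d p))%classic.
  move=> z /(EsetP z hp hd) fle1; exists (eigenvector d p z); split.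
  - by exists 1 => n; exact: eigenvector_le1.
  (* The entry at 0 is the empty product 1, so the eigenvector is nonzero. *)
  - move=> /funeqP/(_ 0%N)/eqP; rewrite /eigenvector /=.
    by rewrite oner_eq0.
  - by apply/funext => n; exact: eigenvectorP.
have PS : (point_spectrum (Sop d p) `<=` spectrum (Sop d p))%classic.
  move=> z [w [lw w0 Sw]] [B [Bop BA]]; apply: w0.
  have [<- _] := BA _ lw.
  have l0 : linf (fun=> 0 : R[i]) by exists 0 => n; rewrite normc0.
  have -> : sub_scalar (Sop d p) z w = (fun=> 0).
    by apply/funext => n; rewrite /sub_scalar Sw subrr.
  (* $S - z$ sends both [w] and 0 to 0, so a left inverse gives $w = 0$. *)
  have [B0 _] := BA _ l0; rewrite -[RHS]B0; congr B; apply/funext => n.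
  rewrite /sub_scalar (S_sum hd0) mulr0 subr0 big1// => m _.
  by rewrite mulr0.
have SE : (spectrum (Sop d p) `<=` Eset d p)%classic.
  move=> z zS; apply/(EsetP z hp hd) => j; rewrite leNgt; apply/negP => fj1.
  apply: zS; apply: boundedly_bijective_invertible => //.
  exact: boundedly_bijective_ftilde fj1.
by split; apply/seteqP; split=> z; [move=> /EP/PS|exact: SE|move=> /SE/EP|exact: PS].
Qed.
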